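(* Let $q$ be an odd prime power, $r\in\{1,2\}$, $\xi$ a nonsquare in $\mathbb{F}_q$, and $a\in\mathbb{F}_{q^3}^*$ with $N_{q^3/q}(a)=-1$. Let $\mathcal{D}_A=(\mathbb{F}_{q^3}\times\mathbb{F}_{q^3},+,\star_A)$ be the presemifield with multiplication $$(u,v)\star_A(x,y)=(u,v)\begin{pmatrix} x & y\\ A_{a,r}(y) & \xi A_{a,r}(x)\end{pmatrix}=\big(ux+vA_{a,r}(y),\ uy+\xi vA_{a,r}(x)\big),$$ where $A_{a,r}(x)=x^{q^r}-a x^{q^{-r}}$. Then, for fixed $q$, all such presemifields $\mathcal{D}_A$ (over all admissible $r,\xi,a$) are pairwise isotopic, and each of them is isotopic to the presemifield $(\mathbb{F}_{q^6},+,\star)$ with multiplication $$x\star y=(\alpha+\beta u+\gamma u^2)x+\gamma b\,x^{q^3},$$ for a suitable choice of $u\in\mathbb{F}_{q^3}\setminus\mathbb{F}_q$, $\sigma\in\mathbb{F}_q^*$ and $b\in\mathbb{F}_{q^6}$ with $u^3=\sigma u+1$ and $b^{q^3+1}=\sigma^2+9u+3\sigma u^2$; here, for $y\in\mathbb{F}_{q^6}$, the elements $\alpha,\beta,\gamma\in\mathbb{F}_{q^2}$ are the unique ones with $y=\alpha+\beta u+\gamma(b+u^2)$.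
   Context: $N_{q^3/q}(a)=a^{1+q+q^2}$ is the norm from $\mathbb{F}_{q^3}$ to $\mathbb{F}_q$. For $x\in\mathbb{F}_{q^3}$, $x^{q^{-r}}$ denotes $x^{q^{3-r}}$. A presemifield is a finite algebra satisfying the axioms of a skewfield except associativity of multiplication and existence of an identity. Two presemifields $(\mathbb{S},+,\cdot)$, $(\mathbb{S}',+,\circ)$ of characteristic $p$ are isotopic if there are bijective $\mathbb{F}_p$-linear maps $g_1,g_2,g_3$ with $g_1(x\cdot y)=g_2(x)\circ g_3(y)$ for all $x,y$. *)

(* Defs.v *)
From HB Require Import structures.
From mathcomp Require Import all_boot all_order all_algebra all_fingroup all_field.

Set Implicit Arguments.
Unset Strict Implicit.
Unset Printing Implicit Defensive.

Import GRing.Theory.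
Local Open Scope ring_scope.

(* The finZmodType structure of a product of two finite additive groups. *)
HB.saturate prod.

(* (S, +) is a group by typing; as S is finite, the absence of zero divisors  *)
(* makes left and right multiplication by a nonzero element bijective.        *)
Definition presemifield (S : finZmodType) (mul : S -> S -> S) : Prop :=
  [/\ exists x : S, x != 0,
      forall x y z, mul (x + y) z = mul x z + mul y z,
      forall x y z, mul x (y + z) = mul x y + mul x z
    & forall x y, mul x y = 0 -> x = 0 \/ y = 0].

(* In characteristic p the scalar k of 'F_p acts on v as v *+ k. *)
Definition Fp_linear (p : nat) (V W : zmodType) (g : V -> W) : Prop :=
  {morph g : x y / x + y} /\
  (forall (k : 'F_p) (v : V), g (v *+ k) = g v *+ k).

Definition isotopic (p : nat) (S S' : finZmodType)
    (mul : S -> S -> S) (mul' : S' -> S' -> S') : Prop :=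
  exists g1 g2 g3 : S -> S',
    [/\ Fp_linear p g1 /\ bijective g1,
        Fp_linear p g2 /\ bijective g2,
        Fp_linear p g3 /\ bijective g3
      & forall x y, g1 (mul x y) = mul' (g2 x) (g3 y)].

(* The subfield of order m of the finite field K, when K has one. *)
Definition subF (K : finFieldType) (m : nat) : {pred K} :=
  [pred x | x ^+ m == x].

Section DA.
Variables (K : finFieldType) (q : nat).

(* The following are meant for #|K| = q ^ 3. *)
Definition normq3 (a : K) : K := a ^+ (1 + q + q ^ 2).

Definition A_op (a : K) (r : nat) (x : K) : K :=
  x ^+ (q ^ r) - a * x ^+ (q ^ (3 - r)).

Definition admissible (r : nat) (xi a : K) : Prop :=
  [/\ r = 1%N \/ r = 2%N,
      xi \in subF q,
      forall z, z \in subF q -> z ^+ 2 != xi,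
      a != 0
    & normq3 a = -1].

Definition mulD (r : nat) (xi a : K) (s t : K * K) : K * K :=
  (s.1 * t.1 + s.2 * A_op a r t.2, s.1 * t.2 + xi * s.2 * A_op a r t.1).

End DA.

Section Star.
Variables (L : finFieldType) (q : nat) (u b : L).

(* The following are meant for #|L| = q ^ 6. *)
Definition is_coords (y : L) (t : L * L * L) : bool :=
  let: (alpha, beta, gamma) := t in
  [&& alpha \in subF (q ^ 2), beta \in subF (q ^ 2),
      gamma \in subF (q ^ 2)
    & y == alpha + beta * u + gamma * (b + u ^+ 2)].

(* The value (0, 0, 0) is junk, for y without coordinates. *)
Definition coords (y : L) : L * L * L :=
  odflt (0, 0, 0) [pick t | is_coords y t].

Definition star (x y : L) : L :=
  let: (alpha, beta, gamma) := coords y in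
  (alpha + beta * u + gamma * u ^+ 2) * x + gamma * b * x ^+ (q ^ 3).

Definition star_params (sigma : L) : Prop :=
  [/\ (u \in subF (q ^ 3)) /\ (u \notin subF q),
      (sigma \in subF q) /\ sigma != 0,
      u ^+ 3 = sigma * u + 1
    & b ^+ (q ^ 3 + 1) = sigma ^+ 2 + 9%:R * u + 3%:R * sigma * u ^+ 2].

End Star.

(* Main.v *)
(* Hilbert 90 rescales both factors so that a = -1, where A x = Tr x - x with *)
(* Tr the trace from F_q^3 to F_q, independently of r.  Let i in F_q^6 be a   *)
(* square root of xi, so that i^(q^3) = -i, and let T be the trace from F_q^6 *)
(* to F_q^2.  With X = x + y/i and w = s - i t, the product (s, t) * (x, y)   *)
(* is (X - T X / 2) w + (T X / 2) w^(q^3), in which xi no longer occurs.      *)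
(* On the other side let u be a root of P = X^3 - sigma X - 1 and put         *)
(* delta = 1 / P'(u).  The value required of b^(q^3 + 1) is P'(u)^2, so that  *)
(* b = - P'(u) is a legitimate choice.  Lagrange interpolation at the         *)
(* conjugates of u over F_q^2 gives T (y delta) = - 2 gamma, whence           *)
(* delta (x star y) = (Y - T Y / 2) x + (T Y / 2) x^(q^3) for Y = y delta:    *)
(* this is the same product.                                                  *)
Require Import Defs.
From HB Require Import structures.
From mathcomp Require Import all_boot all_order all_algebra all_fingroup.
From mathcomp Require Import all_solvable all_field.
From mathcomp Require Import ring zify.

Set Implicit Arguments.
Unset Strict Implicit.
Unset Printing Implicit Defensive.

Import GRing.Theory.
Local Open Scope ring_scope.

(** Every D_A is compared with one fixed star algebra, chosen independently of r, xi and a, so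
    pairwise isotopy is symmetry and transitivity. Write P = X^3 - sigma X - 1. [cubic_without_root]
    finds sigma such that P has no root in F_q, and [trinomial_root] then gives a root u in F_q^3; b
    = - P'(u) completes the parameters. On one side [mulD_isotopic_normal_form] reduces to a = -1
    and r = 1. On the other, [coords_trace] and [starE] express star by the trace T alone.
    [mulD_isotopic_star] matches the two formulas by means of the square root i of xi from
    [sqrt_of_nonsquare]. Absence of zero divisors is proved only for the normal form, where a zero
    divisor would make xi a square in F_q ([mulD_presemifield]); isotopy carries it to all D_A and
    to star. *)

(** * Finite fields: powers, roots and embeddings *)

(** The unit group is cyclic of order d m, generated by some g; if g^k is killed by m, then d
    divides k. *)
Lemma finField_exp_root (F : finFieldType) (d m : nat) (x : F) :
  (d * m = #|F|.-1)%N -> x ^+ m = 1 -> exists y, y ^+ d = x.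
Proof.
move=> dm xm1.
have F1 := finNzRing_gt1 F.
have dm_gt0 : (0 < d * m)%N by rewrite dm -subn1 subn_gt0.
have m_gt0 : (0 < m)%N by move: dm_gt0; rewrite muln_gt0 => /andP[].
have x0 : x != 0.
  by apply: contra_eq_neq xm1 => ->; rewrite expr0n eqn0Ngt m_gt0 eq_sym oner_eq0.
have /cyclicP[g gE] := field_unit_group_cyclic [set: {unit F}].
have /cycleP[k kE] : finField_unit x0 \in <[g]>%g by rewrite -gE inE.
have og : #[g]%g = (d * m)%N by rewrite orderE -gE card_finField_unit dm.
have /dvdnP[j kj] : (d %| k)%N.
  rewrite -(@dvdn_pmul2r m) // -og order_dvdn expgM -kE.
  by apply/eqP/val_inj; rewrite FinRing.val_unitX.
exists (val (g ^+ j)%g).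
by rewrite -FinRing.val_unitX -expgM -kj -kE.
Qed.

Lemma finField_root (F : finFieldType) (P : {poly F}) :
  (1 < size P)%N -> P %| 'X^#|F| - 'X -> exists x, root P x.
Proof.
move=> P1; rewrite finField_genPoly => /dvdp_prod_XsubC[m Pm].
move: P1; rewrite (eqp_size Pm).
case: (mask m _) Pm => [|x s] Pm; first by rewrite big_nil size_poly1.
by exists x; rewrite (eqp_root Pm) root_prod_XsubC inE eqxx.
Qed.

(** A generator [a] of the unit group of K has a minimal polynomial m over F_p, which divides X^#|L|
    - X because [a] is a root of the latter. So m has a root b in L, and P(a) -> P(b) is well
    defined on K, all of whose elements are polynomials in [a]. *)
Lemma finField_embedding (p : nat) (K L : finFieldType) :
  p \in [pchar K] -> p \in [pchar L] -> (forall x : K, x ^+ #|L| = x) ->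
  inhabited {rmorphism K -> L}.
Proof.
move=> chK chL KL.
have /cyclicP[g gE] := field_unit_group_cyclic [set: {unit K}].
pose K' := pPrimeCharType chK; pose L' := pPrimeCharType chL.
pose a : K' := val g.
have /polyOver1P[m mE] := minPolyOver 1%AS a.
have evE (R : algType 'F_p) (c : R) P : horner_alg c P = (map_poly (in_alg R) P).[c] by [].
have ker_a P : horner_alg a P = 0 -> m %| P.
  move=> Pa; rewrite -(dvdp_map (in_alg K')) -mE minPoly_dvdp //.
    by apply/polyOver1P; exists P.
  by rewrite rootE -evE Pa.
have [||b mb] := @finField_root L (map_poly (in_alg L') m).
- by rewrite (size_map_poly (in_alg L')) -(size_map_poly (in_alg K')) -mE size_minPoly.
- have mX : map_poly (in_alg L') m %| map_poly (in_alg L') ('X^#|L| - 'X).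
    rewrite dvdp_map; apply: ker_a.
    by rewrite rmorphB rmorphXn /= horner_algX (KL a) subrr.
  by move: mX; rewrite rmorphB /= map_polyXn map_polyX.
have ker_b P : horner_alg a P = 0 -> horner_alg (b : L') P = 0.
  move=> /ker_a/dvdpP[Q ->]; rewrite rmorphM /=.
  by rewrite [X in _ * X]evE (rootP mb) mulr0.
have surj (x : K') : exists P, horner_alg a P == x.
  have [->|x0] := eqVneq x 0; first by exists 0; rewrite rmorph0.
  have /cycleP[k kE] : finField_unit x0 \in <[g]>%g by rewrite -gE inE.
  exists 'X^k; rewrite rmorphXn /= horner_algX.
  by rewrite -[x]/(val (finField_unit x0)) kE FinRing.val_unitX.
pose f (x : K') : L' := horner_alg (b : L') (xchoose (surj x)).
have fE P x : horner_alg a P = x -> f x = horner_alg (b : L') P.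
  move=> Px; apply/eqP; rewrite -subr_eq0 -rmorphB; apply/eqP/ker_b.
  by rewrite rmorphB /= (eqP (xchooseP (surj x))) Px subrr.
have fP x : {P | horner_alg a P = x & f x = horner_alg (b : L') P}.
  by exists (xchoose (surj x)); first apply/eqP/(xchooseP (surj x)).
have fB : zmod_morphism f.
  move=> x y; have [P Px ->] := fP x; have [Q Qy ->] := fP y.
  by rewrite (fE (P - Q)) ?rmorphB //= Px Qy.
have fM : monoid_morphism f.
  split; first by rewrite (fE 1) ?rmorph1.
  move=> x y; have [P Px ->] := fP x; have [Q Qy ->] := fP y.
  by rewrite (fE (P * Q)) ?rmorphM //= Px Qy.
pose fA := GRing.isZmodMorphism.Build K' L' f fB.
pose fR := GRing.isMonoidMorphism.Build K' L' f fM.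
exact: (inhabits (HB.pack_for {rmorphism K' -> L'} f fA fR)).
Qed.
Lemma in_alg_fixed (F : finFieldType) (M : fieldExtType F) (x : M) :
  x ^+ #|F| = x -> exists y : F, x = y%:A.
Proof.
move=> xF.
have : root (map_poly (in_alg M) ('X^#|F| - 'X)) x.
  by rewrite rmorphB /= map_polyXn map_polyX rootE !hornerE xF subrr.
rewrite finField_genPoly rmorph_prod /= /root horner_prod prodf_seq_eq0.
case/hasP=> y _ /=; rewrite map_polyXsubC hornerXsubC subr_eq0 => /eqP ->.
by exists y.
Qed.

(** * The cubic X^3 - s X - 1 *)

(* z is a root of X^3 - s X - 1 iff s = z^2 - 1/z.  As 1 yields s = 0, these  *)
(* values cannot exhaust the nonzero elements of F_q.                         *)
Lemma cubic_without_root (F : finFieldType) (q : nat) :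
  exists sigma : F, [/\ sigma \in subF q, sigma != 0
    & forall z, z \in subF q -> z ^+ 3 != sigma * z + 1].
Proof.
pose B := [set z : F | (z \in subF q) && (z != 0)].
pose f (z : F) := z ^+ 2 - z^-1.
have B1 : 1 \in B by rewrite !inE expr1n eqxx oner_eq0.
have /subsetPn[s] : ~~ (B \subset f @: (B :\ 1)).
  apply/negP=> /subset_leq_card; rewrite leqNgt => /negP; apply.
  by apply: leq_ltn_trans (leq_imset_card _ _) _; rewrite [ltnRHS](cardsD1 1) B1.
rewrite inE => /andP[sq s0] sf; exists s; split=> // z zq.
apply: contraNneq sf => zs.
have z0 : z != 0.
  by apply: contra_eq_neq zs => ->; rewrite mulr0 add0r expr0n /= eq_sym oner_eq0.
apply/imsetP; exists z; last first.
  apply: (mulIf z0); rewrite /f mulrBl mulVf //.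
  by apply/eqP; rewrite -exprSr zs addrK.
rewrite !inE z0 andbT [X in _ && X]zq andbT.
apply: contraNneq s0 => z1; move: zs.
by rewrite z1 expr1n mulr1 => /eqP; rewrite -subr_eq subrr eq_sym.
Qed.

(** The alternating sum of the cubes is the Vandermonde product times x + y + z; it vanishes because
    the cubes are the values of one affine function. *)
Lemma trinomial_root_sum (F : fieldType) (s x y z : F) :
  x ^+ 3 = s * x + 1 -> y ^+ 3 = s * y + 1 -> z ^+ 3 = s * z + 1 ->
  x != y -> x != z -> y != z -> x + y + z = 0.
Proof.
move=> hx hy hz xy xz yz.
rewrite -subr_eq0 in xy; rewrite -subr_eq0 in xz; rewrite -subr_eq0 in yz.
apply: (mulfI xy); apply: (mulfI xz); apply: (mulfI yz).
rewrite !mulr0.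
have -> : (y - z) * ((x - z) * ((x - y) * (x + y + z))) =
  x ^+ 3 * (y - z) - y ^+ 3 * (x - z) + z ^+ 3 * (x - y) by ring.
by rewrite hx hy hz; ring.
Qed.

Lemma frobB (R : comNzRingType) (q : nat) (x y : R) :
  [pchar R].-nat q -> (x - y) ^+ q = x ^+ q - y ^+ q.
Proof. by move=> qR; rewrite exprDn_pchar // exprNn_pchar. Qed.

(* The q-Frobenius has no fixed point on the three roots, hence permutes them *)
(* cyclically.                                                                *)
Lemma trinomial_root (F : finFieldType) (q k : nat) (s : F) :
    [pchar F].-nat q -> #|F| = (q ^ (3 * k))%N -> s \in subF q ->
    (forall z, z \in subF q -> z ^+ 3 != s * z + 1) ->
  exists u : F, [/\ u \in subF (q ^ 3), u \notin subF q & u ^+ 3 = s * u + 1].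
Proof.
move=> qF cardF /eqP sq noroot.
pose P : {poly F} := 'X^3 - (s *: 'X + 1).
have sP : size P = 4.
  rewrite size_polyDl size_polyXn // size_polyN.
  apply: leq_ltn_trans (size_polyD _ _) _.
  rewrite size_poly1 gtn_max /= andbT.
  by apply: leq_ltn_trans (size_scale_leq _ _) _; rewrite size_polyX.
have P0 : P != 0 by rewrite -size_poly_eq0 sP.
have [M [rs PM _]] := FinSplittingFieldFor P0.
have rootP_M (w : M) : root (map_poly (in_alg M) P) w = (w ^+ 3 == s%:A * w + 1).
  rewrite /P rmorphB rmorphD /= map_polyXn rmorph1 map_polyZ /= map_polyX.
  by rewrite rootE !hornerE subr_eq0.
have qM : [pchar M].-nat q by rewrite (eq_pnat _ (pchar_lalg M)).
have rootq (w : M) : w ^+ 3 = s%:A * w + 1 -> (w ^+ q) ^+ 3 = s%:A * w ^+ q + 1.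
  move=> w3; rewrite exprAC w3 exprDn_pchar // expr1n exprMn.
  by congr (_ * _ + _); rewrite -[LHS](rmorphXn (in_alg M)) sq.
have noroot_M (w : M) : w ^+ 3 = s%:A * w + 1 -> w ^+ q != w.
  move=> w3; apply/eqP=> wq; have [|v wv] := @in_alg_fixed F M w.
    (* A fixed point of the q-Frobenius is fixed by its iterate x^#|F|, hence lies in F. *)
    rewrite cardF; elim: (3 * k)%N => [|j IHj]; first by rewrite expn0 expr1.
    by rewrite expnS exprM wq.
  have inj := fmorph_inj (in_alg M).
  have vq : v \in subF q by apply/eqP/inj; rewrite rmorphXn /= -wv.
  have /negP := noroot v vq; apply.
  apply/eqP/inj; rewrite rmorphXn rmorphD rmorphM rmorph1 /=.
  by rewrite -wv.
have [u u3] : exists u : M, u ^+ 3 = s%:A * u + 1.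
  have := sP; rewrite -(size_map_poly (in_alg M)) (eqp_size PM).
  case: rs PM => [|u rs PM _]; first by rewrite big_nil size_poly1.
  exists u; apply/eqP; rewrite -rootP_M (eqp_root PM) root_prod_XsubC.
  exact: mem_head.
set u1 := u ^+ q; set u2 := u1 ^+ q.
have u13 : u1 ^+ 3 = s%:A * u1 + 1 by apply: rootq.
have u23 : u2 ^+ 3 = s%:A * u2 + 1 by apply: rootq.
have uu1 : u != u1 by rewrite eq_sym noroot_M.
have u1u2 : u1 != u2 by rewrite eq_sym noroot_M.
have uu2 : u != u2.
  (* If the Frobenius merely swapped u and u1, it would fix the third root - (u + u1). *)
  apply/eqP=> uu2; suff /noroot_M/eqP[] : (- (u + u1)) ^+ 3 = s%:A * - (u + u1) + 1.
    by rewrite exprNn_pchar // exprDn_pchar // -/u1 -/u2 -uu2 addrC.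
  rewrite -subr_eq0 in uu1; apply: (mulfI uu1).
  apply/eqP; rewrite -subr_eq0; apply/eqP; move: (s%:A) u3 u13 => t u3 u13.
  transitivity (- (u + 2%:R * u1) * (u ^+ 3 - (t * u + 1))
    + (2%:R * u + u1) * (u1 ^+ 3 - (t * u1 + 1))); first by ring.
  by rewrite u3 u13 !subrr !mulr0 addr0.
have sum0 := trinomial_root_sum u3 u13 u23 uu1 uu2 u1u2.
(* The Frobenius image of [sum0]; comparing the two sums gives u^(q^3) = u. *)
have sum1 : u1 + u2 + u2 ^+ q = 0.
  have q_gt0 : (0 < q)%N by case/andP: qM.
  by rewrite -!exprDn_pchar // sum0 expr0n eqn0Ngt q_gt0.
have u_q3 : u ^+ (q ^ 3) = u.
  rewrite !expnS expn0 muln1 !exprM -/u1 -/u2.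
  by apply: (addrI (u1 + u2)); rewrite sum1 addrC addrA sum0.
have [|v uv] := @in_alg_fixed F M u.
  rewrite cardF expnM; elim: k {cardF} => [|j IHj]; first by rewrite expn0 expr1.
  by rewrite expnS exprM u_q3.
have inj := fmorph_inj (in_alg M).
exists v; split.
- by apply/eqP/inj; rewrite rmorphXn /= -uv.
- by apply: contraNN uu1 => /eqP vq; rewrite /u1 uv -(rmorphXn (in_alg M)) vq.
- by apply: inj; rewrite rmorphXn rmorphD rmorphM rmorph1 /= -uv.
Qed.

(** * Isotopy as an equivalence relation *)

Lemma additive_Fp_linear (p : nat) (V W : zmodType) (g : V -> W) :
  {morph g : x y / x + y} -> Fp_linear p g.
Proof.
move=> gD; split=> // k v.
have g0 : g 0 = 0 by apply: (addrI (g 0)); rewrite -gD !addr0.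
elim: (k : nat) => [|n IHn]; first by rewrite !mulr0n.
by rewrite !mulrS gD IHn.
Qed.

Lemma isotopic_by_injections (p : nat) (S S' : finZmodType)
    (mul : S -> S -> S) (mul' : S' -> S' -> S') (g1 g2 g3 : S -> S') :
    #|S'| = #|S| ->
    {morph g1 : x y / x + y} -> injective g1 ->
    {morph g2 : x y / x + y} -> injective g2 ->
    {morph g3 : x y / x + y} -> injective g3 ->
    (forall x y, g1 (mul x y) = mul' (g2 x) (g3 y)) ->
  isotopic p mul mul'.
Proof.
move=> cS g1D g1I g2D g2I g3D g3I gM; exists g1, g2, g3.
by split=> //; split; first [exact: additive_Fp_linear | apply: inj_card_bij; rewrite ?cS].
Qed.

Lemma isotopic_sym (p : nat) (S S' : finZmodType)
    (mul : S -> S -> S) (mul' : S' -> S' -> S') :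
  isotopic p mul mul' -> isotopic p mul' mul.
Proof.
case=> g1 [g2 [g3 [[[g1D _] g1B] [[g2D _] g2B] [[g3D _] g3B] gM]]].
have invD (g : S -> S') g' : {morph g : x y / x + y} -> cancel g g' ->
    cancel g' g -> {morph g' : x y / x + y}.
  by move=> gD gK g'K x y; apply: (can_inj gK); rewrite gD !g'K.
case: (g1B) (g2B) (g3B) => g1' g1K g1'K [g2' g2K g2'K] [g3' g3K g3'K].
exists g1', g2', g3'; split.
- by split; [apply/additive_Fp_linear/(invD g1) | exists g1].
- by split; [apply/additive_Fp_linear/(invD g2) | exists g2].
- by split; [apply/additive_Fp_linear/(invD g3) | exists g3].
by move=> x y; apply: (can_inj g1K); rewrite g1'K gM g2'K g3'K.
Qed.

Lemma isotopic_trans (p : nat) (S S' S'' : finZmodType) (mul : S -> S -> S)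
    (mul' : S' -> S' -> S') (mul'' : S'' -> S'' -> S'') :
  isotopic p mul mul' -> isotopic p mul' mul'' -> isotopic p mul mul''.
Proof.
case=> f1 [f2 [f3 [[[f1D _] f1B] [[f2D _] f2B] [[f3D _] f3B] fM]]].
case=> g1 [g2 [g3 [[[g1D _] g1B] [[g2D _] g2B] [[g3D _] g3B] gM]]].
have compD (f : S -> S') (g : S' -> S'') : {morph f : x y / x + y} ->
    {morph g : x y / x + y} -> {morph g \o f : x y / x + y}.
  by move=> fD gD x y; rewrite /= fD gD.
exists (g1 \o f1), (g2 \o f2), (g3 \o f3); split.
- by split; [apply/additive_Fp_linear/compD | apply: bij_comp].
- by split; [apply/additive_Fp_linear/compD | apply: bij_comp].
- by split; [apply/additive_Fp_linear/compD | apply: bij_comp].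
by move=> x y; rewrite /= fM gM.
Qed.

Lemma isotopic_presemifield (p : nat) (S S' : finZmodType)
    (mul : S -> S -> S) (mul' : S' -> S' -> S') :
  isotopic p mul mul' -> presemifield mul -> presemifield mul'.
Proof.
case=> g1 [g2 [g3 [[[g1D _] g1B] [[g2D _] g2B] [[g3D _] g3B] gM]]].
case=> [[x0 x0N] mDl mDr m0].
have add0 (g : S -> S') : {morph g : x y / x + y} -> g 0 = 0.
  by move=> gD; apply: (addrI (g 0)); rewrite -gD !addr0.
case: (g1B) (g2B) (g3B) => g1' g1K g1'K [g2' g2K g2'K] [g3' g3K g3'K].
split.
- by exists (g1 x0); rewrite -(add0 _ g1D) (can_eq g1K).
- by move=> x y z; rewrite -[x]g2'K -[y]g2'K -[z]g3'K -g2D -!gM mDl g1D.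
- by move=> x y z; rewrite -[x]g2'K -[y]g3'K -[z]g3'K -g3D -!gM mDr g1D.
move=> x y; rewrite -[x]g2'K -[y]g3'K -gM => xy0.
have /m0 : mul (g2' x) (g3' y) = 0 by apply: (can_inj g1K); rewrite xy0 add0.
by case=> ->; [left | right]; apply: add0.
Qed.

(** * Reduction to a = -1 and absence of zero divisors *)

Section NormalForm.
Variables (p q : nat) (K : finFieldType).
Hypotheses (qK : [pchar K].-nat q) (q_odd : odd q) (cardK : #|K| = (q ^ 3)%N).

Lemma expr_q3 (x : K) : x ^+ q ^+ q ^+ q = x.
Proof. by rewrite -!exprM -[RHS]expf_card cardK !expnS expn0 muln1 mulnA. Qed.

Lemma A_opD (a : K) (r : nat) (x y : K) : A_op q a r (x + y) = A_op q a r x + A_op q a r y.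
Proof. by rewrite /A_op !exprDn_pchar ?pnatX ?qK //; ring. Qed.

(** The condition on c gives both terms of A (c x) the same factor. What remains is x^q + x^(q^2),
    symmetric under exchange of r = 1 and r = 2. *)
Lemma A_op_twist (a c x : K) (r : nat) :
  r = 1%N \/ r = 2%N -> a * c ^+ (q ^ (3 - r)) = - c ^+ (q ^ r) ->
  A_op q a r (c * x) = c ^+ (q ^ r) * A_op q (-1) 1 x.
Proof.
rewrite /A_op => r12 ac.
rewrite !exprMn mulrA ac.
by case: r12 => -> /=; ring.
Qed.

(** Hilbert 90: the norm has odd exponent, so - a has norm 1 and equals e^(q-1) for some e; c is a
    conjugate of e or of its inverse. *)
Lemma twist_exists (a : K) (r : nat) : r = 1%N \/ r = 2%N -> normq3 q a = -1 ->
  exists2 c : K, c != 0 & a * c ^+ (q ^ (3 - r)) = - c ^+ (q ^ r).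
Proof.
move=> r12 Na.
have q_gt0 : (0 < q)%N by case/andP: qK.
have [||e eE] := @finField_exp_root K q.-1 (1 + q + q ^ 2) (- a).
- by rewrite cardK; case: (q) q_gt0 => // m _; lia.
- rewrite exprNn -/(normq3 q a) Na -signr_odd !oddD oddX q_odd /=.
  by rewrite expr1 mulrNN mulr1.
have a0 : a != 0.
  apply: contra_eq_neq Na => ->.
  by rewrite /normq3 expr0n addn_eq0 eq_sym oppr_eq0 oner_eq0.
have e0 : e != 0.
  apply: contra_eq_neq eE => ->; rewrite expr0n eq_sym.
  have := finNzRing_gt1 K; rewrite cardK.
  by case: (q) => [|[|m]] //; rewrite oppr_eq0.
have eqE : e ^+ q = - a * e by rewrite -eE -exprSr prednK.
have e3 := expr_q3 e.
case: r12 => ->; [exists (e ^+ q ^+ q)^-1 | exists (e ^+ q ^+ q)].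
- by rewrite invr_eq0 !expf_neq0.
- rewrite expn1 /= !expnS expn0 muln1 exprM !exprVn e3 eqE.
  by field; rewrite oppr_eq0 a0 e0.
- by rewrite !expf_neq0.
- by rewrite expn1 /= !expnS expn0 muln1 exprM e3 eqE; ring.
Qed.

Lemma mulD_isotopic_normal_form (r : nat) (xi a : K) :
    r = 1%N \/ r = 2%N -> normq3 q a = -1 ->
  isotopic p (mulD q 1 xi (-1)) (mulD q r xi a).
Proof.
move=> r12 /(twist_exists r12)[c c0 ac].
have cr0 : c ^+ (q ^ r) != 0 by rewrite expf_neq0.
apply: (@isotopic_by_injections _ _ _ _ _ id
  (fun s => (c^-1 * s.1, (c ^+ (q ^ r))^-1 * s.2)) (fun t => (c * t.1, c * t.2))) => //.
- by move=> s t; rewrite /= !mulrDr.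
- move=> [s1 s2] [t1 t2] /= [].
  by move=> /(mulfI (invr_neq0 c0)) -> /(mulfI (invr_neq0 cr0)) ->.
- by move=> s t; rewrite /= !mulrDr.
- by move=> [s1 s2] [t1 t2] /= [] /(mulfI c0) -> /(mulfI c0) ->.
move=> [s1 s2] [t1 t2]; rewrite /mulD /= !(A_op_twist _ r12 ac).
by congr (_, _); field; rewrite c0 cr0.
Qed.

Hypothesis two_neq0 : 2%:R != 0 :> K.

(** Eliminating s1 from a vanishing product with s2 nonzero gives y A(y) = xi x A(x). This forces y
    y^(q^2) = xi x x^(q^2), and the product of the three conjugates of this relation is N(y)^2 =
    xi^3 N(x)^2. *)
Lemma mulD_presemifield (xi : K) :
    xi \in subF q -> (forall z, z \in subF q -> z ^+ 2 != xi) ->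
  presemifield (mulD q 1 xi (-1)).
Proof.
move=> /eqP xiq xiN.
split.
- by exists (1, 0); rewrite -pair_eqE /= oner_eq0.
- by move=> [x1 x2] [y1 y2] [z1 z2]; rewrite /mulD; congr (_, _) => /=; ring.
- by move=> [x1 x2] [y1 y2] [z1 z2]; rewrite /mulD !A_opD; congr (_, _) => /=; ring.
move=> [s1 s2] [x y]; rewrite /mulD /= => /eqP.
rewrite -pair_eqE /= => /andP[/eqP eq1 /eqP eq2].
have [s20|s2_neq0] := eqVneq s2 0.
  move/eqP: eq1; move/eqP: eq2; rewrite s20 !(mulr0, mul0r) !addr0 !mulf_eq0.
  have [->|_ /= /eqP-> /eqP->] := eqVneq s1 0; by [left | right].
right.
pose x1 := x ^+ q; pose x2 := x1 ^+ q; pose y1 := y ^+ q; pose y2 := y1 ^+ q.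
have x2q : x2 ^+ q = x by apply: expr_q3.
have y2q : y2 ^+ q = y by apply: expr_q3.
have AE (z : K) : A_op q (-1) 1 z = z ^+ q + z ^+ q ^+ q.
  by rewrite /A_op mulN1r opprK expn1 -exprM mulnn.
rewrite !AE -/x1 -/x2 -/y1 -/y2 in eq1 eq2.
(* A z * z = (z z^(q^2))^q + z z^(q^2), so that Z^q = - Z. *)
pose Z := y * y2 - xi * (x * x2).
have ZqE : Z ^+ q = y1 * y - xi * (x1 * x).
  by rewrite /Z frobB // !exprMn x2q y2q xiq.
have ZN : Z ^+ q = - Z.
  apply/eqP; rewrite -addr_eq0 -(mulrI_eq0 _ (mulfI s2_neq0)) ZqE; apply/eqP.
  rewrite -[RHS](mulr0 (y - x)) /Z.
  transitivity (y * (s1 * x + s2 * (y1 + y2)) - x * (s1 * y + xi * s2 * (x1 + x2))).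
    by ring.
  by rewrite eq1 eq2; ring.
(* Three applications of the Frobenius give Z = - Z. *)
have Z0 : Z = 0.
  have := expr_q3 Z; rewrite !(ZN, exprNn_pchar) // !opprK => /eqP.
  rewrite eq_sym -addr_eq0 -mulr2n -mulr_natl mulf_eq0 (negPf two_neq0) /=.
  by move/eqP.
have E0 : y * y2 = xi * (x * x2) by apply/subr0_eq.
have E1 : y1 * y = xi * (x1 * x).
  by apply/subr0_eq; rewrite -ZqE ZN Z0 oppr0.
have E2 : y2 * y1 = xi * (x2 * x1).
  by rewrite -[y2]/(y1 ^+ q) -[y1 in LHS]/(y ^+ q) -exprMn E1 !exprMn xiq.
have q_gt0 : (0 < q)%N by case/andP: qK.
have [x0|x_neq0] := eqVneq x 0.
  move/eqP: E0; rewrite x0 mul0r mulr0 mulf_eq0 !expf_eq0 q_gt0 /= orbb.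
  by move/eqP ->.
have x1_neq0 : x1 != 0 by rewrite expf_neq0.
have x2_neq0 : x2 != 0 by rewrite expf_neq0.
have zq : (0 : K) \in subF q by apply/eqP; rewrite expr0n eqn0Ngt q_gt0.
have xi_neq0 : xi != 0 by have := xiN 0 zq; rewrite expr0n eq_sym.
(* w = N(y) / (xi N(x)) lies in F_q and has square xi. *)
set w := y * y1 * y2 / (xi * (x * x1 * x2)).
have wq : w \in subF q.
  apply/eqP; rewrite /w expr_div_n !exprMn y2q x2q xiq -/x1 -/y1 -/x2 -/y2.
  by congr (_ / (_ * _)); ring.
have /eqP[] := xiN w wq.
have -> : w ^+ 2 = (y * y2) * (y1 * y) * (y2 * y1) / (xi * (x * x1 * x2)) ^+ 2.
  by rewrite /w expr_div_n; congr (_ / _); ring.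
by rewrite E0 E1 E2; field; rewrite xi_neq0 x_neq0 x1_neq0 x2_neq0.
Qed.

End NormalForm.

(** * Lagrange interpolation at the roots of a cubic *)

Section Lagrange.
Variables (F : fieldType) (x y z f g h s : F).
Hypotheses (xy : x - y != 0) (xz : x - z != 0) (yz : y - z != 0).
Hypotheses (sum0 : x + y + z = 0) (sE : s = - (x * y + x * z + y * z)).

Let yx : y - x != 0. Proof. by rewrite -opprB oppr_eq0. Qed.
Let zx : z - x != 0. Proof. by rewrite -opprB oppr_eq0. Qed.
Let zy : z - y != 0. Proof. by rewrite -opprB oppr_eq0. Qed.

(** The inverse of the derivative at x of the monic cubic with roots x, y, z. The three sums below
    are the X^2-coefficients of the interpolants of 1, X and X^2. *)
Let dx := ((x - y) * (x - z))^-1.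
Let dy := ((y - x) * (y - z))^-1.
Let dz := ((z - x) * (z - y))^-1.

Lemma lagrange_sum0 : dx + dy + dz = 0.
Proof. by rewrite /dx /dy /dz; field; rewrite xy xz yx yz zx zy. Qed.

Lemma lagrange_sum1 : x * dx + y * dy + z * dz = 0.
Proof. by rewrite /dx /dy /dz; field; rewrite xy xz yx yz zx zy. Qed.

Lemma lagrange_sum2 : x ^+ 2 * dx + y ^+ 2 * dy + z ^+ 2 * dz = 1.
Proof. by rewrite /dx /dy /dz; field; rewrite xy xz yx yz zx zy. Qed.

(** For P = X^3 - s X - xyz, the quotient of P by X - x is X^2 + x X + (x^2 - s); these
    coefficients, for each root, produce the three sums. *)
Lemma lagrange_interpolation :
  f = (f * ((x ^+ 2 - s) * dx) + g * ((y ^+ 2 - s) * dy) + h * ((z ^+ 2 - s) * dz))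
    + (f * (x * dx) + g * (y * dy) + h * (z * dz)) * x
    + (f * dx + g * dy + h * dz) * x ^+ 2.
Proof.
have zE : z = - (x + y) by apply/eqP; rewrite -addr_eq0 addrC sum0.
have xdx : (x - y) * (x - z) * dx = 1 by rewrite mulfV // mulf_neq0.
transitivity (f * ((x - y) * (x - z) * dx)); first by rewrite xdx mulr1.
by rewrite sE zE; ring.
Qed.

End Lagrange.

(** * The star product in terms of the trace to F_q^2 *)

Section StarTrace.
Variables (q : nat) (L : finFieldType).
Hypotheses (qL : [pchar L].-nat q) (cardL : #|L| = (q ^ 6)%N).
Hypothesis two_neq0 : 2%:R != 0 :> L.

Definition tr_q6_q2 (x : L) := x + x ^+ (q ^ 2) + x ^+ (q ^ 2) ^+ (q ^ 2).
Local Notation T := tr_q6_q2.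

Let q2L : [pchar L].-nat (q ^ 2)%N.
Proof. by rewrite pnatX qL. Qed.

Let expr_q6 (x : L) : x ^+ (q ^ 2) ^+ (q ^ 2) ^+ (q ^ 2) = x.
Proof. by rewrite -!exprM -!expnD -[RHS]expf_card cardL. Qed.

Lemma tr_q6_q2D : {morph T : x y / x + y}.
Proof. by move=> x y; rewrite /T !exprDn_pchar //; ring. Qed.

Lemma tr_q6_q2Zl (c x : L) : c \in subF (q ^ 2) -> T (c * x) = c * T x.
Proof. by move=> /eqP cq; rewrite /T !exprMn !cq; ring. Qed.

Lemma tr_q6_q2_fixed (x : L) : T x \in subF (q ^ 2).
Proof. by apply/eqP; rewrite /T !exprDn_pchar // expr_q6; ring. Qed.

Variables (u s : L).
Hypotheses (uq3 : u \in subF (q ^ 3)) (uNq : u \notin subF q).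
Hypotheses (sq : s \in subF q) (u3 : u ^+ 3 = s * u + 1).

Let u1 := u ^+ (q ^ 2).
Let u2 := u1 ^+ (q ^ 2).
Let delta := (3%:R * u ^+ 2 - s)^-1.
Let b := s - 3%:R * u ^+ 2.

(** As u lies in F_q^3, u2 = u^(q^4) = u^q, which differs from u; any coincidence among the
    conjugates would give u = u2. *)
Let conjugates : [/\ u - u1 != 0, u - u2 != 0, u1 - u2 != 0 & u + u1 + u2 = 0].
Proof.
have uq : u ^+ (q ^ 3) = u by apply/eqP.
have uNq' : u ^+ q != u by [].
have u2E : u2 = u ^+ q.
  by rewrite /u2 /u1 -exprM -expnD (_ : 2 + 2 = 3 + 1)%N // expnD exprM uq.
have uu2 : u != u2 by rewrite u2E eq_sym.
have uu1 : u != u1.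
  apply: contraNneq uu2 => uu1; rewrite /u2 -uu1; exact/eqP.
have u1u2 : u1 != u2.
  apply: contraNneq uu2 => u12; rewrite -[u in u == _]expr_q6 -/u1 -/u2.
  by rewrite -{1}u12.
have fix2 : s ^+ (q ^ 2) = s by rewrite expnS expn1 exprM !(eqP sq).
have root1 (x : L) : x ^+ 3 = s * x + 1 -> (x ^+ (q ^ 2)) ^+ 3 = s * x ^+ (q ^ 2) + 1.
  by move=> x3; rewrite exprAC x3 exprDn_pchar // expr1n exprMn fix2.
have u13 := root1 u u3; have u23 := root1 u1 u13.
by split; rewrite ?subr_eq0 //; apply: (@trinomial_root_sum L s).
Qed.

Let sE : s = - (u * u1 + u * u2 + u1 * u2).
Proof.
have [uu1 uu2 u1u2 sum0] := conjugates.
have u2E : u2 = - (u + u1) by apply/eqP; rewrite -addr_eq0 addrC sum0.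
have fix2 : s ^+ (q ^ 2) = s by rewrite expnS expn1 exprM !(eqP sq).
have u13 : u1 ^+ 3 = s * u1 + 1.
  by rewrite /u1 exprAC u3 exprDn_pchar // expr1n exprMn fix2.
apply: (mulfI uu1); rewrite u2E.
transitivity (s * u + 1 - (s * u1 + 1)); first by ring.
by rewrite -u3 -u13; ring.
Qed.

Let deltaE : delta = ((u - u1) * (u - u2))^-1.
Proof.
have [_ _ _ sum0] := conjugates.
have u2E : u2 = - (u + u1) by apply/eqP; rewrite -addr_eq0 addrC sum0.
by rewrite /delta sE u2E; congr (_^-1); ring.
Qed.

Let delta1E : delta ^+ (q ^ 2) = ((u1 - u) * (u1 - u2))^-1.
Proof.
by rewrite deltaE exprVn exprMn !frobB // -/u1 -/u2 [u2 ^+ _]expr_q6 [X in X^-1]mulrC.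
Qed.

Let delta2E : delta ^+ (q ^ 2) ^+ (q ^ 2) = ((u2 - u) * (u2 - u1))^-1.
Proof.
by rewrite delta1E exprVn exprMn !frobB // -/u1 -/u2 [u2 ^+ _]expr_q6 mulrC.
Qed.

Lemma trinomial_deriv_neq0 : 3%:R * u ^+ 2 - s != 0.
Proof.
have [uu1 uu2 _ _] := conjugates.
by rewrite -invr_eq0 -/delta deltaE invr_eq0 mulf_neq0.
Qed.

Let delta_neq0 : delta != 0.
Proof. by rewrite invr_eq0 trinomial_deriv_neq0. Qed.

Let bE : b = - delta^-1.
Proof. by rewrite /b /delta invrK opprB. Qed.

Let b_delta : b * delta = -1.
Proof. by rewrite bE mulNr mulVf. Qed.

Let tr_delta : T delta = 0.
Proof.
have [uu1 uu2 u1u2 _] := conjugates.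
by rewrite /T delta2E delta1E deltaE lagrange_sum0.
Qed.

Let tr_u_delta : T (u * delta) = 0.
Proof.
have [uu1 uu2 u1u2 _] := conjugates.
by rewrite /T !exprMn delta2E delta1E deltaE -/u1 -/u2 lagrange_sum1.
Qed.

Let tr_u2_delta : T (u ^+ 2 * delta) = 1.
Proof.
have [uu1 uu2 u1u2 _] := conjugates.
rewrite /T !exprMn -/u1 -/u2 delta2E delta1E deltaE.
exact: lagrange_sum2.
Qed.

Let interpolation (f : L) :
  f = T (f * ((u ^+ 2 - s) * delta)) + T (f * (u * delta)) * u
    + T (f * delta) * u ^+ 2.
Proof.
have [uu1 uu2 u1u2 sum0] := conjugates.
have fix2 : s ^+ (q ^ 2) = s by rewrite expnS expn1 exprM !(eqP sq).
rewrite /T !exprMn !frobB // !fix2.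
rewrite ![_ ^+ 2 ^+ _]exprAC -/u1 -/u2.
rewrite delta2E delta1E deltaE.
exact: lagrange_interpolation.
Qed.

Let tr_b_delta (c : L) : c \in subF (q ^ 2) -> T (c * b * delta) = - 3%:R * c.
Proof.
move=> cq; rewrite -mulrA tr_q6_q2Zl // b_delta.
by rewrite /T !exprNn_pchar // !expr1n; ring.
Qed.

(** 1 and u contribute nothing, u^2 contributes 1, and b contributes T(-1) = - 3, since b delta = -
    1. *)
Lemma coords_trace (y al be ga : L) : is_coords q u b y (al, be, ga) ->
  T (y * delta) = - 2%:R * ga.
Proof.
case/and4P=> alq beq gaq /eqP ->.
have -> : (al + be * u + ga * (b + u ^+ 2)) * delta =
  al * delta + be * (u * delta) + ga * (u ^+ 2 * delta) + ga * b * delta by ring.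
rewrite !tr_q6_q2D tr_b_delta // (tr_q6_q2Zl _ alq).
rewrite (tr_q6_q2Zl _ beq) (tr_q6_q2Zl _ gaq).
rewrite tr_delta tr_u_delta tr_u2_delta.
by ring.
Qed.

(** The trace determines gamma; [interpolation] of y - gamma b supplies alpha and beta. These are
    unique because 1 and u are independent over F_q^2, u being moved by the q^2-Frobenius. *)
Lemma coords_uniq (y : L) : exists! t : L * L * L, is_coords q u b y t.
Proof.
pose ga := - 2%:R^-1 * T (y * delta).
have two2 : (2%:R : L) \in subF (q ^ 2).
  by apply/eqP; rewrite -[2%:R]/(1 + 1) exprDn_pchar // !expr1n.
have gaq : ga \in subF (q ^ 2).
  apply/eqP; rewrite /ga exprMn exprNn_pchar // exprVn (eqP two2).
  by rewrite (eqP (tr_q6_q2_fixed _)).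
pose f := y - ga * b.
have Tf : T (f * delta) = ga.
  have -> : T (f * delta) = T (y * delta) - T (ga * b * delta).
    by rewrite -[RHS]/(_ + _) /f mulrBl /T !frobB //; ring.
  by rewrite tr_b_delta // /ga; field.
exists (T (f * ((u ^+ 2 - s) * delta)), T (f * (u * delta)), ga); split.
  rewrite /is_coords gaq !tr_q6_q2_fixed /=; apply/eqP.
  transitivity (f + ga * b); first by rewrite /f; ring.
  by rewrite [f in LHS]interpolation Tf; ring.
move=> [[al be] ga'] tP; have ga'E := coords_trace tP.
have gaE : ga' = ga by rewrite /ga ga'E; field.
move: tP; rewrite gaE => /and4P[/eqP alq /eqP beq _ /eqP yE].
have [uu1 _ _ _] := conjugates.
have fE : f = al + be * u + ga * u ^+ 2 by rewrite /f yE; ring.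
set al' := T (f * ((u ^+ 2 - s) * delta)); set be' := T (f * (u * delta)).
have al'q : al' ^+ (q ^ 2) = al' by apply/eqP/tr_q6_q2_fixed.
have be'q : be' ^+ (q ^ 2) = be' by apply/eqP/tr_q6_q2_fixed.
have eq0 : (al' - al) + (be' - be) * u = 0.
  transitivity (f - ga * u ^+ 2 - (al + be * u)); last by rewrite fE; ring.
  by rewrite [f in RHS]interpolation Tf -/al' -/be'; ring.
have eq1 : (al' - al) + (be' - be) * u1 = 0.
  have := congr1 (fun x => x ^+ (q ^ 2)) eq0.
  rewrite exprDn_pchar // exprMn !frobB // alq beq al'q be'q -/u1 => ->.
  by rewrite expr0n expn_eq0 eqn0Ngt; case/andP: qL => ->.
have beE : be' = be.
  apply/subr0_eq/(mulIf uu1); rewrite mul0r.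
  transitivity ((al' - al) + (be' - be) * u - ((al' - al) + (be' - be) * u1)).
    by ring.
  by rewrite eq0 eq1 subrr.
by move: eq0; rewrite beE subrr mul0r addr0 => /subr0_eq ->.
Qed.

(** Here t = - gamma, and the coefficient of x in the star product is y - gamma b with b = - 1 /
    delta. *)
Lemma starE (x y : L) : let t := 2%:R^-1 * T (y * delta) in
  star q u b x y = delta^-1 * ((y * delta - t) * x + t * x ^+ (q ^ 3)).
Proof.
rewrite /star; have [t tP] : {t | is_coords q u b y t}.
  by apply: sigW; have [t [tP _]] := coords_uniq y; exists t.
have {tP} : is_coords q u b y (coords q u b y).
  rewrite /coords; case: pickP => [//|/(_ t)]; by rewrite tP.
case: (coords q u b y) => [[al be] ga] tP; rewrite (coords_trace tP) /=.
have -> : 2%:R^-1 * (- 2%:R * ga) = - ga by field.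
case/and4P: tP => _ _ _ /eqP ->.
have d : delta^-1 * delta = 1 by rewrite mulVf.
transitivity ((al + be * u + ga * (b + u ^+ 2)) * x * (delta^-1 * delta)
  + ga * x * delta^-1 - ga * x ^+ (q ^ 3) * delta^-1); last by ring.
by rewrite d -[delta^-1]opprK -bE; ring.
Qed.

(** b lies in F_q^3, so b^(q^3 + 1) = b^2, which u^3 = s u + 1 reduces to the required value. *)
Lemma star_params_trinomial : s != 0 -> star_params q u b s.
Proof.
move=> s0; split=> //.
have q3L : [pchar L].-nat (q ^ 3)%N by rewrite pnatX qL.
have sq3 : s ^+ (q ^ 3) = s by rewrite !expnS expn0 muln1 !exprM !(eqP sq).
have three : (3%:R : L) ^+ (q ^ 3) = 3%:R.
  by rewrite -[3%:R]/(1 + (1 + 1)) !exprDn_pchar // !expr1n.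
have -> : b ^+ (q ^ 3 + 1) = b ^+ 2.
  rewrite exprD expr1 {1}/b frobB // exprMn exprAC (eqP uq3) three sq3.
  by rewrite -/b expr2.
transitivity (s ^+ 2 - 6%:R * s * u ^+ 2 + 9%:R * u * u ^+ 3); first by rewrite /b; ring.
by rewrite u3; ring.
Qed.

End StarTrace.

(** * The isotopism between D_A and star *)

(** Euler's criterion: xi^((q-1)/2) = - 1, since otherwise xi is the square of a norm from F_q^3.
    Then i^q = i (i^2)^((q-1)/2) = - i. *)
Lemma sqrt_of_nonsquare (q : nat) (K L : finFieldType)
    (iota : {rmorphism K -> L}) (xi : K) :
    odd q -> #|K| = (q ^ 3)%N -> #|L| = (q ^ 6)%N -> xi \in subF q ->
    (forall z, z \in subF q -> z ^+ 2 != xi) ->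
  exists2 i : L, i ^+ 2 = iota xi & i ^+ q = - i.
Proof.
move=> q_odd cardK cardL /eqP xiq xiN.
pose m := q./2.
have qE : q = (m.*2).+1 by rewrite -[LHS]odd_double_half q_odd.
have q0 : (0 : K) \in subF q by apply/eqP; rewrite expr0n qE.
have xi0 : xi != 0 by have := xiN 0 q0; rewrite expr0n eq_sym.
have xi_2m : xi ^+ m.*2 = 1.
  by apply: (mulfI xi0); rewrite -exprS -qE xiq mulr1.
have xi_m : xi ^+ m = -1.
  have : (xi ^+ m - 1) * (xi ^+ m + 1) == 0.
    by rewrite -subr_sqr expr1n -exprM muln2 xi_2m subrr.
  rewrite mulf_eq0 subr_eq0 addr_eq0 => /orP[/eqP xi_m1|/eqP //].
  have [||y yE] := @finField_exp_root K (2 * (1 + q + q ^ 2)) m xi.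
  - by rewrite cardK qE -muln2; lia.
  - by [].
  have zq : y ^+ (1 + q + q ^ 2) \in subF q.
    apply/eqP.
    have yq : y ^+ (q ^ 3) = y by rewrite -cardK expf_card.
    rewrite -exprM (_ : ((1 + q + q ^ 2) * q = q ^ 3 + (q + q ^ 2))%N); last by ring.
    by rewrite exprD yq -exprS.
  by have /eqP[] := xiN _ zq; rewrite -exprM mulnC.
(* The exponent is (q + 1)(1 + q^2 + q^4) = (q^6 - 1) / (q - 1). *)
have [||y yE] := @finField_exp_root L (m.+1 * (1 + q ^ 2 + q ^ 4) * 2) m.*2 (iota xi).
- by rewrite cardL qE -muln2; lia.
- by rewrite -rmorphXn xi_2m rmorph1.
exists (y ^+ (m.+1 * (1 + q ^ 2 + q ^ 4))); first by rewrite -exprM.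
set i := y ^+ _.
have i2 : i ^+ 2 = iota xi by rewrite -exprM.
by rewrite qE -muln2 mulnC exprS exprM i2 -rmorphXn xi_m rmorphN1 mulrN1.
Qed.

Section Isotopism.
Variables (p q : nat) (K L : finFieldType) (iota : {rmorphism K -> L}).
Hypotheses (qL : [pchar L].-nat q) (q_odd : odd q).
Hypotheses (cardK : #|K| = (q ^ 3)%N) (cardL : #|L| = (q ^ 6)%N).
Hypothesis two_neq0 : 2%:R != 0 :> L.

Let iota_q3 (x : K) : iota x ^+ (q ^ 3) = iota x.
Proof. by rewrite -rmorphXn -cardK expf_card. Qed.

(** Conjugation by x^(q^3) changes the sign of the k-part only, so both parts can be recovered. Used
    with k = 1/i and k = - i. *)
Lemma quadratic_pair_inj (k : L) : k != 0 -> k ^+ (q ^ 3) = - k ->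
  injective (fun t : K * K => iota t.1 + k * iota t.2).
Proof.
move=> k0 kq [x1 x2] [y1 y2] /= eq0.
have q3L : [pchar L].-nat (q ^ 3)%N by rewrite pnatX qL.
have := congr1 (fun x => x ^+ (q ^ 3)) eq0.
rewrite !exprDn_pchar // !exprMn kq !iota_q3 => eq1.
have xy1 : x1 = y1.
  apply/(fmorph_inj iota)/(mulfI two_neq0).
  transitivity ((iota x1 + k * iota x2) + (iota x1 + - k * iota x2)); first by ring.
  by rewrite eq0 eq1; ring.
by move: eq0; rewrite xy1 => /addrI/(mulfI k0)/(fmorph_inj iota) ->.
Qed.

Lemma mulD_isotopic_star (xi : K) (u s : L) :
    xi \in subF q -> (forall z, z \in subF q -> z ^+ 2 != xi) ->
    u \in subF (q ^ 3) -> u \notin subF q -> s \in subF q -> u ^+ 3 = s * u + 1 ->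
  isotopic p (mulD q 1 xi (-1)) (star q u (s - 3%:R * u ^+ 2)).
Proof.
move=> xiq xiN uq3 uNq sq u3.
have [i i2 iq] := sqrt_of_nonsquare iota q_odd cardK cardL xiq xiN.
have q0 : (0 : K) \in subF q by apply/eqP; rewrite expr0n; case: (q) q_odd.
have xi0 : iota xi != 0 by rewrite fmorph_eq0; have := xiN 0 q0; rewrite expr0n eq_sym.
have i0 : i != 0 by apply: contraNneq xi0 => i0; rewrite -i2 i0 expr0n.
have iq2 : i ^+ (q ^ 2) = i by rewrite expnS expn1 exprM iq exprNn_pchar // iq opprK.
have iq3 : i ^+ (q ^ 3) = - i by rewrite expnS mulnC exprM iq2.
pose delta := (3%:R * u ^+ 2 - s)^-1.
have d0 : delta != 0 by rewrite invr_eq0 (@trinomial_deriv_neq0 q).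
have d0' : delta^-1 != 0 by rewrite invr_eq0.
pose emb (t : K * K) := iota t.1 + i^-1 * iota t.2.
have embD : {morph emb : s t / s + t} by move=> x y; rewrite /emb /= !rmorphD; ring.
have emb_inj : injective emb.
  by apply: quadratic_pair_inj; rewrite ?invr_eq0 // exprVn iq3 invrN.
(* [starE] multiplies its right argument by delta and its value by 1 / delta, hence the factors in
   the first and third maps. *)
apply: (@isotopic_by_injections _ _ _ _ _ (fun t => delta^-1 * emb t)
  (fun s => iota s.1 - i * iota s.2) (fun t => delta^-1 * emb t)).
- by rewrite card_prod cardK cardL -expnD.
- by move=> x y; rewrite embD mulrDr.
- by move=> x y /(mulfI d0')/emb_inj.
- by move=> x y; rewrite /= !rmorphD; ring.
- move=> x y xy; apply: (@quadratic_pair_inj (- i)); rewrite ?oppr_eq0 //.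
    by rewrite exprNn_pchar ?pnatX ?qL // iq3.
  by rewrite !mulNr.
- by move=> x y; rewrite embD mulrDr.
- by move=> x y /(mulfI d0')/emb_inj.
move=> [s1 s2] [x y]; set X := emb (x, y).
rewrite starE // -/delta (mulrAC _ _ delta) mulVf // mul1r; congr (_ * _).
have q3L : [pchar L].-nat (q ^ 3)%N by rewrite pnatX qL.
have -> : (iota s1 - i * iota s2) ^+ (q ^ 3) = iota s1 + i * iota s2.
  by rewrite frobB // exprMn iq3 !iota_q3 mulNr opprK.
set t := 2%:R^-1 * _.
(* T fixes i and restricts on F_q^3 to the trace to F_q, which is A + id. *)
have trE : 2%:R * t = X + emb (A_op q (-1) 1 x, A_op q (-1) 1 y).
  rewrite /t mulrA mulfV // mul1r.
  have eq2 (z : K) : iota z ^+ (q ^ 2) ^+ (q ^ 2) = iota z ^+ q.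
    by rewrite -exprM -expnD -[(2 + 2)%N]/(3 + 1)%N expnD exprM iota_q3.
  have q2L : [pchar L].-nat (q ^ 2)%N by rewrite pnatX qL.
  rewrite /tr_q6_q2 /X /emb /= !exprDn_pchar // !exprMn !exprVn !iq2 !eq2.
  by rewrite /A_op !expn1 !rmorphB !rmorphM !rmorphXn !rmorphN1; ring.
rewrite /= in trE *.
transitivity (X * (iota s1 - i * iota s2) + i * iota s2 * (2%:R * t)); last by ring.
rewrite trE /mulD {trE}; move: (A_op q (-1) 1 x) (A_op q (-1) 1 y) => Ax Ay.
rewrite /X /emb /= !rmorphD !rmorphM /= -i2.
by field.
Qed.

End Isotopism.

Theorem theorem3p1 (p h q : nat) (p_prime : prime p) (h_gt0 : (0 < h)%N)
    (qE : q = (p ^ h)%N) (q_odd : odd q)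
    (K : finFieldType) (cardK : #|K| = (q ^ 3)%N)
    (L : finFieldType) (cardL : #|L| = (q ^ 6)%N) :
  [/\ forall (r : nat) (xi a : K), admissible q r xi a ->
        presemifield (mulD q r xi a),
      forall (r r' : nat) (xi xi' a a' : K),
        admissible q r xi a -> admissible q r' xi' a' ->
        isotopic p (mulD q r xi a) (mulD q r' xi' a')
    & forall (r : nat) (xi a : K), admissible q r xi a ->
        exists u sigma b : L,
          [/\ star_params q u b sigma,
              forall y : L, exists! t : L * L * L, is_coords q u b y t,
              presemifield (star q u b)
            & isotopic p (mulD q r xi a) (star q u b)]].
Proof.
have p_odd : odd p by move: q_odd; rewrite qE oddX eqn0Ngt h_gt0.
have char_facts (F : finFieldType) n : #|F| = (q ^ n)%N ->
    [/\ p \in [pchar F], [pchar F].-nat q & 2%:R != 0 :> F].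
  move=> cardF; have pF : p \in [pchar F].
    by apply: (@card_finPcharP _ p (h * n)); rewrite // cardF qE expnM.
  split=> //; first by rewrite qE pnatX pnatE // pF.
  rewrite -(dvdn_pcharf pF) dvdn_prime2 //.
  by apply: contraTneq p_odd => ->.
have [pK qK two_K] := char_facts K 3%N cardK.
have [pL qL two_L] := char_facts L 6%N cardL.
have [|iota] := @finField_embedding p K L pK pL.
  by move=> x; rewrite cardL (expnM q 3 2) expnS expn1 exprM -cardK !expf_card.
have [s [sq s0 noroot]] := cubic_without_root L q.
have [u [uq3 uNq u3]] := trinomial_root (k := 2) qL cardL sq noroot.
pose b := s - 3%:R * u ^+ 2.
(* The same u and b serve all admissible r, xi and a. *)
have to_star r (xi a : K) : admissible q r xi a -> isotopic p (mulD q r xi a) (star q u b).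
  case=> r12 xiq xiN _ Na.
  have nf := mulD_isotopic_normal_form p qK q_odd cardK xi r12 Na.
  apply: isotopic_trans (isotopic_sym nf) _.
  exact: (mulD_isotopic_star p iota).
have D_presemifield r (xi a : K) : admissible q r xi a -> presemifield (mulD q r xi a).
  case=> r12 xiq xiN _ Na.
  have nf := mulD_isotopic_normal_form p qK q_odd cardK xi r12 Na.
  apply: isotopic_presemifield nf _.
  exact: mulD_presemifield.
split=> [|r r' xi xi' a a' adm adm'|r xi a adm]; first exact: D_presemifield.
  exact: isotopic_trans (to_star _ _ _ adm) (isotopic_sym (to_star _ _ _ adm')).
exists u, s, b; split.
- exact: star_params_trinomial.
- exact: coords_uniq.
- exact: isotopic_presemifield (to_star _ _ _ adm) (D_presemifield _ _ _ adm).
- exact: to_star.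
Qed.
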